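(* Let $\alpha,\beta>0$ be rationally independent real numbers. For any two complex numbers $p,q$ one can find a continuous function $f:\mathbb{R}\to\mathbb{C}$ vanishing at infinity and satisfying $$\sum_{k\in\mathbb{Z}} f(x-k\alpha)=p,\qquad \sum_{k\in\mathbb{Z}} f(x-k\beta)=q\qquad\text{for a.e. } x\in\mathbb{R},$$ where both series converge absolutely for a.e. $x$.
   Context: Two positive real numbers $\alpha,\beta$ are rationally independent if $n\alpha+m\beta=0$ with $n,m\in\mathbb{Z}$ implies $n=m=0$ (equivalently, $\alpha/\beta$ is irrational). ''Vanishing at infinity'' means $f(x)\to 0$ as $|x|\to\infty$. *)

(* Defs.v *)
From mathcomp Require Import all_boot all_order all_algebra.
From mathcomp Require Import all_classical all_reals all_analysis.
From mathcomp Require Import complex.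
From mathcomp.analysis.showcase Require summability.

Set Implicit Arguments.
Unset Strict Implicit.
Unset Printing Implicit Defensive.

Import Order.TTheory GRing.Theory Num.Theory.
Import numFieldNormedType.Exports.

Local Open Scope classical_set_scope.
Local Open Scope ring_scope.
Local Open Scope complex_scope.

(* The topology of the complex numbers is the one of R[i]^o, whose balls are
   those of the complex modulus. *)

Definition rationally_independent (R : realType) (alpha beta : R) : Prop :=
  forall n m : int,
    n%:~R * alpha + m%:~R * beta = 0 -> n = 0 /\ m = 0.

(* The filter on R of the limits as |x| tends to infinity. *)
Definition norm_infty (R : realType) : set_system R :=
  filter_from setT (fun M : R => [set x : R | M < `|x|]).
Arguments norm_infty R : clear implicits.

Global Instance norm_infty_filter (R : realType) :
  ProperFilter (norm_infty R).
Proof.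
apply: filter_from_proper.
  apply: filter_from_filter; first by exists 0.
  move=> M N _ _; exists (Num.max M N) => //= x /=.
  by rewrite gt_max => /andP[].
move=> M _; exists (`|M| + 1) => /=.
rewrite ger0_norm ?addr_ge0//.
by rewrite (le_lt_trans (ler_norm M))// ltrDl.
Qed.

Definition vanishes_at_infinity (R : realType) (f : R -> R[i]^o) : Prop :=
  f x @[x --> norm_infty R] --> (0 : R[i]^o).

(* Normc.normc is the complex modulus as an element of R (the
   norm of R[i] takes values in R[i]); absolute convergence makes the sum
   independent of the enumeration of the integers, so it is taken as the limit
   of the sums over the finite sets of integers ordered by inclusion. *)
Definition absolutely_sums_to (R : realType) (a : int -> R[i]^o)
    (s : R[i]^o) : Prop :=
  summable [set: int] (fun k => (Normc.normc (a k))%:E) /\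
  summability.partial_sum a F @[F --> summability.totally] --> s.

(* Main.v *)
(* By linearity and symmetry it suffices to find a real f whose alpha-sums are 0
   and whose beta-sums are 1.  Start from a tent of width beta, whose beta-sums are 1, and
   let e be the profile carried by the alpha-sums.  Chop e into narrow pieces of
   small height, and replace each piece by the difference of two far translates:
   the one that cancels it is at a multiple of alpha, the other one differs from
   it by a multiple of beta, so the beta-sums do not change, and is chosen by density so that
   the piece lands near 0 modulo alpha.  The new profile is concentrated in an arbitrarily
   small interval, at the cost of a correction that is uniformly small and far
   away.  Choosing the first translate close to the lattice of beta as well keeps
   every correction in a small neighbourhood of both lattices.  Iterating, the
   corrections are locally finite, tend to 0 at infinity, and on each coset
   x + alpha Z or x + beta Z other than the lattice itself only finitely many
   of them are seen; so the limit has the required sums (which are finite sums)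
   outside the countable set of lattice points. *)

Require Import Defs.
From mathcomp Require Import all_boot all_order all_algebra.
From mathcomp Require Import all_classical all_reals all_analysis.
From mathcomp Require Import complex.
From mathcomp Require Import finmap lra ring.
Import Order.TTheory GRing.Theory Num.Theory.
Import numFieldNormedType.Exports.
Local Open Scope classical_set_scope.
Local Open Scope ring_scope.
Local Open Scope complex_scope.
Set Implicit Arguments.
Unset Strict Implicit.
Unset Printing Implicit Defensive.

(** * Integer families with finitely many nonzero terms *)

(** Asking the partial sums to be eventually equal to [s] means that finitely many terms are nonzero
    and add up to [s]; no topology on [V] is involved. *)
Definition finsums_to (V : zmodType) (a : int -> V) (s : V) : Prop :=
  \forall F \near summability.totally, summability.partial_sum a F = s.

Lemma finsums_toD (V : zmodType) (a b : int -> V) (s t : V) :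
  finsums_to a s -> finsums_to b t -> finsums_to (fun k => a k + b k) (s + t).
Proof.
move=> [F _ Fa] [G _ Gb]; exists (F `|` G)%fset => // H /=.
rewrite fsubUset => /andP[FH GH].
by rewrite /summability.partial_sum big_split/=; congr (_ + _); [exact: Fa|exact: Gb].
Qed.

Lemma finsums_to_morph (V W : zmodType) (phi : V -> W) (a : int -> V) (s : V) :
  {morph phi : x y / x + y} -> phi 0 = 0 ->
  finsums_to a s -> finsums_to (fun k => phi (a k)) (phi s).
Proof.
move=> phiD phi0 [F _ Fa]; exists F => // H FH.
rewrite /summability.partial_sum -(big_morph phi phiD phi0).
by congr (phi _); exact: Fa.
Qed.

Lemma finsums_toN (V : zmodType) (a : int -> V) (s : V) :
  finsums_to a s -> finsums_to (fun k => - a k) (- s).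
Proof. by apply: finsums_to_morph; [exact: opprD|exact: oppr0]. Qed.

Lemma finsums_to_zero (V : zmodType) (a : int -> V) :
  (forall k, a k = 0) -> finsums_to a 0.
Proof.
move=> a0; exists fset0 => // H _.
by rewrite /summability.partial_sum big1.
Qed.

Lemma finsums_to_support (V : zmodType) (a : int -> V) (F : {fset int}) :
  (forall k, k \notin F -> a k = 0) -> finsums_to a (\sum_(k <- F) a k).
Proof.
move=> aF; exists F => // H /= FH.
rewrite /summability.partial_sum -(big_seq_fsetE _ _ xpredT a)/=.
by rewrite [RHS](big_fset_incl _ FH)// => k _ /aF.
Qed.

(** Adjoining an index to [F] leaves the partial sum unchanged, so its term is 0. *)
Lemma finsums_to_vanish (V : zmodType) (a : int -> V) (s : V) :
  finsums_to a s -> exists F : {fset int}, forall k, k \notin F -> a k = 0.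
Proof.
move=> [F _ Fa]; exists F => k kF.
have := Fa (k |` F)%fset (fsubsetU1 _ _).
rewrite /= -(Fa F (fsubset_refl _)) /summability.partial_sum.
rewrite -!(big_seq_fsetE _ _ xpredT a)/= big_fsetU1//=.
by move/eqP; rewrite -subr_eq0 addrK => /eqP.
Qed.

Lemma finsums_to_shift (V : zmodType) (a : int -> V) (s : V) (j : int) :
  finsums_to a s -> finsums_to (fun k => a (k + j)) s.
Proof.
move=> [F _ Fa]; exists [fset (k - j)%R | k in F]%fset => // H /= FH.
rewrite -(Fa [fset (k + j)%R | k in H]%fset).
  rewrite /summability.partial_sum -!(big_seq_fsetE _ _ xpredT)/=.
  rewrite -(big_seq_fsetE _ H xpredT (fun k => a (k + j)))/=.
  by rewrite big_imfset//= => x y _ _ /addIr.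
apply/fsubsetP => k kF; apply/imfsetP; exists (k - j) => /=; last by rewrite subrK.
by apply: (fsubsetP FH); apply/imfsetP; exists k.
Qed.

Lemma absolutely_sums_to_finsums (R : realType) (a : int -> R[i]^o) (s : R[i]^o) :
  finsums_to a s -> absolutely_sums_to a s.
Proof.
move=> as_; split; last first.
  move=> U /nbhs_singleton Us; case: as_ => F _ Fa.
  by exists F => // H FH /=; rewrite Fa.
have [F aF] := finsums_to_vanish as_.
rewrite /summable (esumID [set` F])//= !setTI.
rewrite [X in _ + X]esum1 ?adde0; last first.
  by move=> k /= /negP/aF ->; rewrite Normc.normc0 normr0.
rewrite esum_fset// fsbig_finite//= set_fsetK.
by elim/big_ind : _ => [|x y|k _]; rewrite ?ltry//; exact: lte_add_pinfty.
Qed.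

(** * Density of the integer combinations of two independent periods *)

Lemma int_ceil_between (R : realType) (x : R) : exists k : int, x <= k%:~R < x + 1.
Proof.
exists (Num.ceil x); rewrite ceil_ge/= -ltrBlDr.
have := ceilB1_lt x; by rewrite intrD/= mulrN1z.
Qed.

(* The infimum e of the positive combinations would otherwise be attained, and
   a and b would both be integer multiples of e. *)
Lemma small_combination (R : realType) (a b : R) : 0 < a -> 0 < b ->
  rationally_independent a b -> forall d : R, 0 < d ->
  exists m n : int, 0 < m%:~R * b + n%:~R * a < d.
Proof.
move=> a0 b0 ab d d0; apply/not_existsP => H.
pose G := [set t : R | 0 < t /\ exists m n : int, t = m%:~R * b + n%:~R * a].
have Gd t : G t -> d <= t.
  move=> [t0 [m [n tE]]]; rewrite leNgt; apply/negP => td; apply: (H m); exists n.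
  by rewrite -tE t0.
have infG : has_inf G.
  split; last by exists d.
  by exists a; split => //; exists 0, 1; rewrite mul0r add0r mul1r.
pose e := inf G.
have e0 : 0 < e by apply: lt_le_trans d0 _; apply: lb_le_inf; [case: infG|].
have lbe t : G t -> e <= t by move=> Gt; apply: ge_inf => //; case: infG.
(* Otherwise [G] has elements e <= u < t < 2 e, and t - u lies in [G] below its infimum. *)
have Ge : G e.
  have [t Gt te] := inf_adherent e0 infG.
  have et := lbe _ Gt.
  have [->//|/eqP nte] := eqVneq e t.
  have [u Gu ue] := @inf_adherent _ G (t - e) ltac:(rewrite subr_gt0 lt_neqAle et andbT; exact/eqP) infG.
  have eu := lbe _ Gu.
  have : G (t - u).
    split; first by move: ue; rewrite -/e; lra.
    case: Gt => _ [m [n ->]]; case: Gu => _ [m' [n' ->]].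
    exists (m - m'), (n - n'); rewrite !intrB; ring.
  by move/lbe; move: te; rewrite -/e => te etu; exfalso; lra.
have mult t : (exists m n : int, t = m%:~R * b + n%:~R * a) ->
    exists k : int, t = k%:~R * e.
  move=> [m [n tE]]; exists (Num.floor (t / e)).
  have fe : (Num.floor (t / e))%:~R * e <= t by rewrite -ler_pdivlMr// floor_le.
  apply/eqP/negPn/negP => nt.
  have : G (t - (Num.floor (t / e))%:~R * e).
    split; first by rewrite subr_gt0 lt_neqAle fe andbT eq_sym.
    case: Ge => _ [m' [n' eE]]; rewrite tE; set f := Num.floor _.
    exists (m - f * m'), (n - f * n').
    rewrite !intrB !intrM [in X in _ - X]eE; ring.
  move=> /lbe; have := floorD1_gt (t / e).
  rewrite ltr_pdivrMr// intrD mulrDl mul1r => h1 h2; lra.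
have [k ak] := mult a ltac:(by exists 0, 1; rewrite mul0r add0r mul1r).
have [l bl] := mult b ltac:(by exists 1, 0; rewrite mul0r addr0 mul1r).
(* From a = k e and b = l e follows l a - k b = 0. *)
have [l0 _] : l = 0 /\ - k = 0.
  apply: ab; rewrite intrN {1}ak bl; ring.
by move: b0; rewrite bl l0 mul0r ltxx.
Qed.

(** Walk from [s] in steps of length t = m b + n a < d until a multiple L a is first reached or
    passed; the overshoot is below t. The target is so distant that j > |M| / b steps are needed,
    and m is nonzero, so |j m b| exceeds M. *)
Lemma dense_far (R : realType) (a b : R) : 0 < a -> 0 < b ->
  rationally_independent a b -> forall s d M : R, 0 < d ->
  exists m n : int, M < `|m%:~R * b| /\ `|s + m%:~R * b - n%:~R * a| <= d.
Proof.
move=> a0 b0 ab s d M d0.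
have [m [n /andP[t0 tda]]] := small_combination a0 b0 ab (d := Num.min d a) ltac:(by rewrite lt_min d0).
move: t0 tda; set t := _ + _ => t0; rewrite lt_min => /andP[td ta].
(* With m = 0 the step t would be a positive multiple of a, against t < a. *)
have m0 : m != 0.
  apply/negP => /eqP m0; move: t0 ta; rewrite /t m0 mul0r add0r pmulr_lgt0// ltr0z => n0.
  by rewrite ltNge ler_peMl ?(ltW a0)// ler1z.
have [L /andP[L1 _]] := int_ceil_between ((s + (`|M| / b + 1) * t) / a).
have [j /andP[j1 j2]] := int_ceil_between ((L%:~R * a - s) / t).
exists (j * m), (L - j * n); split.
  have jM : `|M| / b + 1 <= j%:~R.
    apply: le_trans j1; rewrite ler_pdivlMr// lerBrDl.
    by move: L1; rewrite ler_pdivrMr.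
  rewrite (le_lt_trans (ler_norm M))//.
  have Mb : 0 <= `|M| / b by rewrite divr_ge0// ltW.
  have j0 : 0 <= j%:~R :> R by lra.
  rewrite intrM !normrM (gtr0_norm b0) (ger0_norm j0).
  rewrite -ltr_pdivrMr// (@lt_le_trans _ _ j%:~R)//; first lra.
  by rewrite ler_peMr// -intr_norm ler1z -gtz0_ge1 normr_gt0.
rewrite (_ : _ - _ = s + j%:~R * t - L%:~R * a); last first.
  rewrite /t intrB !intrM; ring.
move: j1 j2; rewrite ler_pdivrMr// -ltrBlDr ltr_pdivlMr// => j1 j2.
rewrite ger0_norm; lra.
Qed.

(** * Sums over the cosets of a lattice *)

Definition lattice_sums_to (R : realType) (a : R) (h : R -> R) (s : R) : Prop :=
  forall x, finsums_to (fun k : int => h (x - k%:~R * a)) s.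

Definition support_within (R : realType) (M : R) (h : R -> R) : Prop :=
  forall x, M < `|x| -> h x = 0.

Lemma lattice_sums_toD (R : realType) (a : R) (g h : R -> R) (s t : R) :
  lattice_sums_to a g s -> lattice_sums_to a h t ->
  lattice_sums_to a (fun x => g x + h x) (s + t).
Proof. by move=> gs ht x; apply: finsums_toD. Qed.

Lemma bounded_support_finsums (R : realType) (a M : R) (h : R -> R) :
  0 < a -> support_within M h ->
  forall x, exists s, finsums_to (fun k : int => h (x - k%:~R * a)) s.
Proof.
move=> a0 hM x.
pose K := (Num.truncn ((M + `|x|) / a)).+1.
pose F := seq_fset tt ([seq Posz i | i <- iota 0 K] ++ [seq Negz i | i <- iota 0 K]).
eexists; apply: (@finsums_to_support _ _ F) => k kF; apply: hM.
have Kk : (K%:R <= `|k|%:~R :> R).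
  rewrite leNgt; apply/negP => kK; case/negP: kF.
  rewrite seq_fsetE mem_cat; apply/orP; case: k kK => n.
    rewrite ger0_norm// ltr_nat => nK.
    by left; apply/mapP; exists n; rewrite ?mem_iota.
  rewrite NegzE normrN ger0_norm// ltr_nat => nK.
  by right; apply/mapP; exists n; rewrite ?NegzE// mem_iota (ltn_trans _ nK).
have : (M + `|x|) / a < K%:R by exact: truncnS_gt.
rewrite ltr_pdivrMr// => MK.
have ka : K%:R * a <= `|k%:~R * a|.
  by rewrite normrM (gtr0_norm a0) (ler_pM2r a0) -intr_norm.
have := lerB_dist (k%:~R * a) x; rewrite distrC; lra.
Qed.

(** Translating by a multiple of [a] only reindexes each sum; this is what makes corrections
    invisible. *)
Lemma lattice_sums_to_translate (R : realType) (a M : R) (h : R -> R) (c : R) (j : int) :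
  0 < a -> support_within M h ->
  lattice_sums_to a (fun x => h (x - (c + j%:~R * a)) - h (x - c)) 0.
Proof.
move=> a0 hM x; have [s hs] := bounded_support_finsums a0 hM (x - c).
rewrite -(subrr s).
apply: finsums_toD; last first.
  apply: finsums_toN; rewrite (_ : (fun _ => _) = (fun k : int => h (x - c - k%:~R * a)))//.
  by apply/funext => k; congr h; ring.
rewrite (_ : (fun _ => _) = (fun k : int => h (x - c - (k + j)%:~R * a))).
  exact: (finsums_to_shift j hs).
by apply/funext => k; congr h; rewrite intrD; ring.
Qed.

(** * Corrections that move a profile close to the origin *)

Definition near_lattice (R : realType) (a r x : R) : Prop :=
  exists k : int, `|x - k%:~R * a| <= r.

(* [g] is a correction invisible to the [b]-sums that replaces the profile [e]
   by [e'] in the [a]-sums. Letting [N] be arbitrary makes the supports of two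
   corrections disjoint, so that the bound [eta] is preserved by addition. *)
Definition concentrable (R : realType) (a b eps eta d : R) (e : R -> R) : Prop :=
  forall N : R, exists g e' : R -> R,
    [/\ continuous g /\ continuous e',
        (exists M, support_within M g) /\ (exists H, forall x, `|e' x| <= H),
        support_within d e' /\ (forall x, `|x| <= N -> g x = 0),
        (forall x, `|g x| <= eta) /\
        (forall x, g x != 0 -> near_lattice a (2 * eps) x /\ near_lattice b (2 * eps) x) &
        lattice_sums_to a (fun x => g x + (e x - e' x)) 0 /\ lattice_sums_to b g 0].

Lemma continuous_fun_add (R : realType) (f g : R -> R) :
  continuous f -> continuous g -> continuous (fun x => f x + g x).
Proof. by move=> cf cg x; apply: cvgD; [exact: cf|exact: cg]. Qed.

Lemma continuous_translate (R : realType) (f : R -> R) (c : R) :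
  continuous f -> continuous (fun x => f (x - c)).
Proof.
move=> cf x; apply: (@continuous_comp _ _ _ (fun x => x - c) f); last exact: cf.
by apply: cvgB; [exact: cvg_id|exact: cvg_cst].
Qed.

Lemma concentrableD (R : realType) (a b eps eta d : R) (e1 e2 : R -> R) :
  concentrable a b eps eta d e1 -> concentrable a b eps eta d e2 ->
  concentrable a b eps eta d (fun x => e1 x + e2 x).
Proof.
move=> c1 c2 N.
have [g1 [f1 [[cg1 cf1] [[M1 gM1] [H1 fH1]] [fd1 gN1] [geta1 gn1] [sa1 sb1]]]] := c1 N.
have [g2 [f2 [[cg2 cf2] [[M2 gM2] [H2 fH2]] [fd2 gN2] [geta2 gn2] [sa2 sb2]]]] :=
  c2 (Num.max N M1).
exists (fun x => g1 x + g2 x), (fun x => f1 x + f2 x).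
have disj x : g1 x = 0 \/ g2 x = 0.
  have [xM|xM] := leP `|x| M1; last by left; exact: gM1.
  by right; apply: gN2; rewrite le_max xM orbT.
split.
- by split; exact: continuous_fun_add.
- split; last by exists (H1 + H2) => x; rewrite (le_trans (ler_normD _ _))// lerD.
  exists (Num.max M1 M2) => x; rewrite gt_max => /andP[x1 x2].
  by rewrite gM1// gM2// addr0.
- split=> x xd; first by rewrite fd1// fd2// addr0.
  by rewrite gN1// gN2 ?addr0// le_max xd.
- by split=> x; have [->|->] := disj x; rewrite ?add0r ?addr0; auto.
- split; last by rewrite -(addr0 0); exact: lattice_sums_toD.
  rewrite (_ : (fun _ => _) =
    fun x => (g1 x + (e1 x - f1 x)) + (g2 x + (e2 x - f2 x))); last first.
    by apply/funext => x; ring.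
  by rewrite -(addr0 0); exact: lattice_sums_toD.
Qed.

(** The correction is a copy of [e] at c + m b minus a copy at c = k a. For the [b]-sums the copies
    cancel. For the [a]-sums the negative copy cancels [e], and the positive one counts as a copy at
    r = m b - n a; as |s + r| <= d / 2, that copy lives in [-d, d]. *)
Lemma concentrable_narrow (R : realType) (a b eps eta d s : R) (e : R -> R) :
  0 < a -> 0 < b -> rationally_independent a b -> rationally_independent b a ->
  0 < d -> d <= eps ->
  continuous e -> support_within eps e -> support_within (d / 2) (fun x => e (x + s)) ->
  (forall x, `|e x| <= eta) ->
  concentrable a b eps eta d e.
Proof.
move=> a0 b0 ab ba d0 deps ce eeps es eeta N.
have eps0 : 0 < eps by exact: lt_le_trans deps.
(* With the roles of the periods exchanged: c = k a is far away and within [eps] of l b, hence close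
   to both lattices. *)
have [k [l [kN kl]]] := dense_far b0 a0 ba 0 (N + eps) eps0.
(* The lower bound on |m b| keeps the second copy off [-N, N] and disjoint from the copy at c. *)
have [m [n [mN mn]]] := dense_far a0 b0 ab s (`|N| + `|k%:~R * a| + 2 * eps) (divr_gt0 d0 (ltr0n _ 2)).
rewrite add0r in kl.
pose c := k%:~R * a.
pose r := m%:~R * b - n%:~R * a.
have e_at y x : e (x - y) != 0 -> `|x - y| <= eps.
  by move=> exy; rewrite leNgt; apply: contra exy => /eeps ->.
have far x : `|x| <= N -> e (x - (c + m%:~R * b)) = 0.
  move=> xN; apply: eeps.
  have h := lerB_dist (m%:~R * b) (x - c).
  have h' := ler_normB x c.
  rewrite (_ : x - (c + m%:~R * b) = - (m%:~R * b - (x - c))); last by ring.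
  have := ler_norm N; rewrite normrN; move: mN; rewrite -/c; lra.
have far' x : `|x| <= N -> e (x - c) = 0.
  move=> xN; apply: eeps; have h := lerB_dist c x; rewrite distrC; move: kN; rewrite -/c; lra.
have disj x : e (x - (c + m%:~R * b)) = 0 \/ e (x - c) = 0.
  have [|x1] := eqVneq (e (x - (c + m%:~R * b))) 0; first by left.
  have [|x2] := eqVneq (e (x - c)) 0; first by right.
  have := e_at _ _ x1; have := e_at _ _ x2 => h1 h2.
  have := ler_normB (x - c) (x - (c + m%:~R * b)).
  rewrite (_ : x - c - _ = m%:~R * b); last by ring.
  have := normr_ge0 (k%:~R * a); have := normr_ge0 N; lra.
exists (fun x => e (x - (c + m%:~R * b)) - e (x - c)), (fun x => e (x - r)).
have cT y : continuous (fun x => e (x - y)) by exact: continuous_translate.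
split.
- split => //.
  by apply: continuous_fun_add => // x; apply: cvgN; exact: cT.
- split; last by exists eta => x.
  exists (eps + `|c| + `|c + m%:~R * b|) => x xM.
  have := normr_ge0 c; have := normr_ge0 (c + m%:~R * b) => h1 h2.
  rewrite !eeps ?subr0//.
    have := lerB_dist x c; lra.
  have := lerB_dist x (c + m%:~R * b); lra.
- split => x xd; last by rewrite far// far'// subr0.
  rewrite (_ : x - r = (x - r - s) + s); last by ring.
  apply: es; rewrite (_ : x - r - s = x - (s + m%:~R * b - n%:~R * a)); last by rewrite /r; ring.
  have := lerB_dist x (s + m%:~R * b - n%:~R * a); lra.
- split=> x.
    by have [->|->] := disj x; rewrite ?sub0r ?subr0 ?normrN.
  have [h|h] := disj x; rewrite h ?sub0r ?subr0 ?oppr_eq0 => exc.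
    move/e_at : exc => exc; split.
      exists k; rewrite -/c; lra.
    exists l; have := ler_normD (x - c) (c - l%:~R * b).
    rewrite addrA subrK; move: kl; rewrite -/c; lra.
  move: (exc) => /e_at exm; split; last first.
    exists (l + m); have := ler_normD (x - (c + m%:~R * b)) (c - l%:~R * b).
    rewrite (_ : _ + (c - _) = x - (l + m)%:~R * b); last by rewrite intrD; ring.
    by move: kl; rewrite -/c; lra.
  (* The narrow support about s enters here: this distance and |s + m b - n a| are both at most d /
     2, so x is within d of (n + k) a. *)
  have exs : `|x - (c + m%:~R * b) - s| <= d / 2.
    rewrite leNgt; apply: contra exc => /es; rewrite subrK => ->//.
  exists (n + k).
  have := ler_normD (x - (c + m%:~R * b) - s) (s + m%:~R * b - n%:~R * a).
  rewrite (_ : _ + (s + _ - _) = x - (n + k)%:~R * a); first lra.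
  by rewrite intrD /c; ring.
- split.
    (* Uses c + m b = r + (k + n) a to pair each copy with one differing from it by a multiple of
       a. *)
    rewrite (_ : (fun _ => _) = fun x =>
      (e (x - (r + (k + n)%:~R * a)) - e (x - r)) + - (e (x - (0 + k%:~R * a)) - e (x - 0))).
      move=> x; rewrite -[X in finsums_to _ X](subrr 0).
      apply: finsums_toD; last apply: finsums_toN.
        exact: (lattice_sums_to_translate _ _ a0 eeps).
      exact: (lattice_sums_to_translate _ _ a0 eeps).
    apply/funext => x; rewrite subr0 add0r -/c (_ : r + _ = c + m%:~R * b); first by ring.
    by rewrite /r /c intrD; ring.
  exact: (lattice_sums_to_translate _ _ b0 eeps).
Qed.

(** * Cutting a profile into narrow and low pieces *)

Lemma exp_three_halves_unbounded (R : realType) (x : R) :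
  exists n : nat, x <= (3 / 2) ^+ n.
Proof.
have h n : 1 + n%:R / 2 <= (3 / 2) ^+ n :> R.
  elim: n => [|n IH]; first by rewrite expr0 mul0r addr0.
  have n0 : 0 <= n%:R :> R by [].
  rewrite exprS -natr1; move: IH; set p := _ ^+ n; lra.
exists (Num.truncn (2 * x)).+1; apply: le_trans (h _).
have := truncnS_gt (2 * x); lra.
Qed.

(** A piecewise linear cutoff, falling from 1 to 0 across the middle third of [s - w, s + w]. *)
Definition ramp (R : realType) (s w x : R) : R :=
  Num.min 1 (Num.max 0 (1 / 2 - (3 / (2 * w)) * (x - s))).

Lemma ramp_bounds (R : realType) (s w x : R) : 0 <= ramp s w x <= 1.
Proof. by rewrite /ramp le_min ler01 le_max lexx ge_min lexx. Qed.

Lemma ramp_left (R : realType) (s w x : R) : 0 < w -> x - s <= - (w / 3) -> ramp s w x = 1.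
Proof.
move=> w0 xs; rewrite /ramp; apply: min_idPl; rewrite le_max.
suff : 3 / (2 * w) * (x - s) <= 3 / (2 * w) * (- (w / 3)).
  rewrite (_ : 3 / (2 * w) * - (w / 3) = - (1 / 2)); last by field; rewrite gt_eqF.
  by move=> h; apply/orP; right; lra.
by rewrite ler_pM2l// divr_gt0// mulr_gt0.
Qed.

Lemma ramp_right (R : realType) (s w x : R) : 0 < w -> w / 3 <= x - s -> ramp s w x = 0.
Proof.
move=> w0 xs; rewrite /ramp.
have : 3 / (2 * w) * (w / 3) <= 3 / (2 * w) * (x - s).
  by rewrite ler_pM2l// divr_gt0// mulr_gt0.
rewrite (_ : 3 / (2 * w) * (w / 3) = 1 / 2); last by field; rewrite gt_eqF.
move=> h; rewrite (max_idPl _); last lra.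
by apply/min_idPr.
Qed.

Lemma continuous_ramp (R : realType) (s w : R) : continuous (ramp s w).
Proof.
move=> x; apply: (@continuous_min R R (cst 1) (fun y => Num.max 0 (1 / 2 - (3 / (2 * w)) * (y - s)))).
  exact: cvg_cst.
apply: (@continuous_max R R (cst 0) (fun y => 1 / 2 - (3 / (2 * w)) * (y - s))).
  exact: cvg_cst.
apply: cvgB; first exact: cvg_cst.
by apply: cvgMr; apply: cvgB; [exact: cvg_id|exact: cvg_cst].
Qed.

(** The ramp and its complement split a support of radius w about s into two overlapping ones of
    radius v = 2 w / 3 about s - v / 2 and s + v / 2, without raising the height. After n cuts the
    radius is d / 2. *)
Lemma concentrable_interval (R : realType) (a b eps eta d : R) (n : nat) :
  0 < a -> 0 < b -> rationally_independent a b -> rationally_independent b a ->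
  0 < d -> d <= eps -> forall (s : R) (e : R -> R),
  continuous e -> support_within eps e ->
  support_within (d / 2 * (3 / 2) ^+ n) (fun x => e (x + s)) ->
  (forall x, `|e x| <= eta) ->
  concentrable a b eps eta d e.
Proof.
move=> a0 b0 ab ba d0 deps; elim: n => [|n IH] s e ce eeps es eeta.
  by apply: (@concentrable_narrow _ _ _ _ _ _ s) => //; rewrite expr0 mulr1 in es.
pose v := d / 2 * (3 / 2) ^+ n.
have v0 : 0 < v by rewrite mulr_gt0 ?divr_gt0// exprn_gt0 ?divr_gt0.
have vE : d / 2 * (3 / 2) ^+ n.+1 = 3 / 2 * v by rewrite exprS /v; ring.
pose w := 3 / 2 * v; have w0 : 0 < w by rewrite /w; lra.
rewrite vE -/w in es.
rewrite (_ : e = fun x => e x * ramp s w x + e x * (1 - ramp s w x)); last first.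
  by apply/funext => x; ring.
have wv : w / 3 = v / 2 by rewrite /w; lra.
have cr := @continuous_ramp R s w.
apply: concentrableD.
- apply: (IH (s - v / 2)).
  + by move=> x; apply: cvgM; [exact: ce|exact: cr].
  + by move=> x /eeps ->; rewrite mul0r.
  + move=> x; rewrite -/v => vx.
    have [xv|xv] := leP x 0.
      rewrite (_ : x + _ = (x - v / 2) + s); last by ring.
      rewrite es ?mul0r// /w.
      by move: vx; rewrite !ler0_norm; lra.
    rewrite (_ : ramp _ _ _ = 0) ?mulr0//; apply: ramp_right => //.
    by move: vx; rewrite gtr0_norm//; lra.
  + move=> x; have /andP[r0 r1] := ramp_bounds s w x.
    by rewrite normrM (le_trans _ (eeta x))// ler_piMr// ger0_norm.
- apply: (IH (s + v / 2)).
  + move=> x; apply: cvgM; first exact: ce.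
    by apply: cvgB; [exact: cvg_cst|exact: cr].
  + by move=> x /eeps ->; rewrite mul0r.
  + move=> x; rewrite -/v => vx.
    have [xv|xv] := leP 0 x.
      rewrite (_ : x + _ = (x + v / 2) + s); last by ring.
      rewrite es ?mul0r// /w.
      by move: vx; rewrite !ger0_norm; lra.
    rewrite (_ : ramp _ _ _ = 1) ?subrr ?mulr0//; apply: ramp_left => //.
    by move: vx; rewrite ltr0_norm//; lra.
  + move=> x; have /andP[r0 r1] := ramp_bounds s w x.
    by rewrite normrM (le_trans _ (eeta x))// ler_piMr// ger0_norm; lra.
Qed.

(** Here the height is cut: both 2/3 e and 1/3 e are lower than [e] by a factor of at least 3 / 2.
    Once it is at most [eta], only the width is left to reduce. *)
Lemma concentrable_bounded (R : realType) (a b eps eta d H : R) :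
  0 < a -> 0 < b -> rationally_independent a b -> rationally_independent b a ->
  0 < d -> d <= eps -> 0 < eta -> forall e : R -> R,
  continuous e -> support_within eps e -> (forall x, `|e x| <= H) ->
  concentrable a b eps eta d e.
Proof.
move=> a0 b0 ab ba d0 deps eta0 e ce eeps eH.
have [n Hn] := exp_three_halves_unbounded (H / eta).
have {Hn}eH x : `|e x| <= eta * (3 / 2) ^+ n.
  by rewrite (le_trans (eH x))// mulrC -ler_pdivrMr.
elim: n e ce eeps eH => [|n IH] e ce eeps eH.
  have [m Hm] := exp_three_halves_unbounded (eps / (d / 2)).
  apply: (@concentrable_interval _ _ _ _ _ _ m _ _ _ _ _ _ 0) => //.
  - move=> x xm; rewrite addr0 eeps// (le_lt_trans _ xm)//.
    by rewrite mulrC -ler_pdivrMr// divr_gt0.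
  - by move=> x; have := eH x; rewrite expr0 mulr1.
rewrite (_ : e = fun x => (2 / 3) * e x + (1 / 3) * e x); last first.
  by apply/funext => x; field.
have p0 : 0 < eta * (3 / 2) ^+ n.
  by rewrite mulr_gt0// exprn_gt0// divr_gt0.
have scale c : 0 <= c -> c <= 2 / 3 -> concentrable a b eps eta d (fun x => c * e x).
  move=> c0 c1; apply: IH.
  - by move=> x; apply: cvgMr; exact: ce.
  - by move=> x /eeps ->; rewrite mulr0.
  - move=> x; rewrite normrM (ger0_norm c0).
    rewrite (@le_trans _ _ (2 / 3 * `|e x|))// ?ler_wpM2r//.
    have := eH x; rewrite exprS mulrCA; lra.
by apply: concentrableD; apply: scale; lra.
Qed.

(** * The initial partition of unity *)

Definition tent (R : realType) (b x : R) : R := Num.max 0 (1 - `|x| / b).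

Lemma continuous_tent (R : realType) (b : R) : continuous (@tent R b).
Proof.
move=> x; apply: (@continuous_max R R (cst 0) (fun y => 1 - `|y| / b)).
  exact: cvg_cst.
apply: cvgB; first exact: cvg_cst.
by apply: cvgMl; exact: norm_continuous.
Qed.

Lemma tent_support (R : realType) (b : R) : 0 < b -> support_within b (@tent R b).
Proof.
move=> b0 x bx; apply/max_idPl.
by rewrite subr_le0 ler_pdivlMr// mul1r ltW.
Qed.

Lemma tent_norm_le1 (R : realType) (b x : R) : 0 < b -> `|tent b x| <= 1.
Proof.
move=> b0; rewrite ger0_norm /tent ?le_max ?lexx// ge_max ler01/=.
by rewrite lerBlDr lerDl divr_ge0// ltW.
Qed.

(** With y = x - k0 b in [0, b), only the translates k0 and k0 + 1 can be nonzero at x; their values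
    are 1 - y / b and y / b. *)
Lemma tent_lattice_sum (R : realType) (b : R) : 0 < b -> lattice_sums_to b (tent b) 1.
Proof.
move=> b0 x; pose k0 := Num.floor (x / b).
have k1 : k0%:~R * b <= x by rewrite -ler_pdivlMr// floor_le.
have k2 : x < k0%:~R * b + b.
  by have := floorD1_gt (x / b); rewrite ltr_pdivrMr// intrD mulrDl mul1r.
rewrite [X in finsums_to _ X](_ : 1 = \sum_(k <- [fset k0; (k0 + 1)%R]%fset) tent b (x - k%:~R * b)).
  apply: finsums_to_support => k; rewrite !inE => /norP[kk kk1].
  have [kk0|kk0] := leP k k0.
    have {kk0 kk}: (k + 1 <= k0)%R by rewrite addrC lez1D lt_neqAle kk kk0.
    rewrite -(ler_int R) intrD -(ler_pM2r b0) mulrDl mul1r => h.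
    apply/max_idPl; rewrite subr_le0 ler_pdivlMr// mul1r ger0_norm; lra.
  have {kk0 kk1} : (k0 + 1 + 1 <= k)%R.
    by rewrite [in X in (X <= _)%R]addrC lez1D lt_neqAle eq_sym kk1 addrC lez1D kk0.
  rewrite -(ler_int R) !intrD -(ler_pM2r b0) !mulrDl mul1r => h.
  apply/max_idPl; rewrite subr_le0 ler_pdivlMr// mul1r ler0_norm; lra.
rewrite big_fsetU1 ?inE/= ?big_seq_fset1; last by rewrite -subr_eq0 opprD addNKr oppr_eq0.
have nb : b != 0 by rewrite gt_eqF.
have bi := divff nb.
have vb y : 0 <= y -> y <= b -> Num.max 0 (1 - y / b) = 1 - y / b.
  by move=> y0 yb; apply/max_idPr; rewrite subr_ge0 ler_pdivrMr// mul1r.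
rewrite /tent intrD mulrDl mul1r ger0_norm; last lra.
rewrite ler0_norm; last lra.
rewrite !vb; [|lra..].
by field.
Qed.

(** * The iteration and its limit *)

Lemma away_from_lattice (R : realType) (a x : R) : 0 < a ->
  (forall k : int, x != k%:~R * a) -> exists2 r, 0 < r & ~ near_lattice a r x.
Proof.
move=> a0 xa; pose k0 := Num.floor (x / a).
have k1 : k0%:~R * a < x.
  by rewrite lt_neqAle eq_sym xa -ler_pdivlMr// floor_le.
have k2 : x < k0%:~R * a + a.
  by have := floorD1_gt (x / a); rewrite ltr_pdivrMr// intrD mulrDl mul1r.
exists (Num.min (x - k0%:~R * a) (k0%:~R * a + a - x) / 2).
  by rewrite divr_gt0// lt_min !subr_gt0 k1.
set m := Num.min _ _.
have m1 : m <= x - k0%:~R * a by rewrite /m ge_min lexx.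
have m2 : m <= k0%:~R * a + a - x by rewrite /m ge_min lexx orbT.
have m0 : 0 < m by rewrite lt_min !subr_gt0 k1.
move=> [k]; rewrite ler_norml => /andP[xk1 xk2].
have [kk0|kk0] := leP k k0.
  have : k%:~R * a <= k0%:~R * a by rewrite (ler_pM2r a0) ler_int.
  lra.
move: kk0; rewrite -lez1D addrC -(ler_int R) intrD -(ler_pM2r a0) mulrDl mul1r; lra.
Qed.

Lemma near_latticeB (R : realType) (a r x : R) (j : int) :
  near_lattice a r (x - j%:~R * a) -> near_lattice a r x.
Proof.
move=> [k]; exists (k + j).
by rewrite (_ : x - _ = x - j%:~R * a - k%:~R * a)// intrD; ring.
Qed.

Lemma near_lattice_le (R : realType) (a r r' x : R) :
  r <= r' -> near_lattice a r x -> near_lattice a r' x.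
Proof. by move=> rr [k kr]; exists k; exact: le_trans rr. Qed.

(* [S] is a triple (partial function F, profile e of its [a]-sums, radius N of
   the support of F). *)
Definition stage (R : realType) (a b : R) (n : nat) (S : (R -> R) * (R -> R) * R) :=
  [/\ continuous S.1.1 /\ continuous S.1.2,
      support_within S.2 S.1.1 /\ n%:R <= S.2,
      support_within (b / n.+1%:R) S.1.2 /\ (exists H, forall x, `|S.1.2 x| <= H),
      lattice_sums_to a (fun x => S.1.1 x - S.1.2 x) 0 &
      lattice_sums_to b S.1.1 1].

(** In order: growing radii and agreement inside them give a locally stationary sequence, the bound
    outside gives decay at infinity, and the location of changes protects the cosets other than the
    lattices. *)
Definition refines (R : realType) (a b : R) (n : nat) (S S' : (R -> R) * (R -> R) * R) :=
  [/\ S.2 <= S'.2, (forall x, `|x| <= S.2 -> S'.1.1 x = S.1.1 x),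
      (forall x, S.2 < `|x| -> `|S'.1.1 x| <= n.+1%:R^-1) &
      forall x, S'.1.1 x != S.1.1 x ->
        near_lattice a (2 * (b / n.+1%:R)) x /\ near_lattice b (2 * (b / n.+1%:R)) x].

Lemma next_stage (R : realType) (a b : R) (n : nat) (S : (R -> R) * (R -> R) * R) :
  0 < a -> 0 < b -> rationally_independent a b -> rationally_independent b a ->
  stage a b n S -> exists S', stage a b n.+1 S' /\ refines a b n S S'.
Proof.
case: S => [[F e] N] a0 b0 ab ba [/= [cF ce] [FN nN] [en [H eH]] Fe Fb].
have p1 : 0 < b / n.+2%:R by rewrite divr_gt0.
have p2 : b / n.+2%:R <= b / n.+1%:R.
  by rewrite (ler_pM2l b0) lef_pV2 ?posrE// ler_nat.
have p3 : 0 < (n.+1%:R : R)^-1 by rewrite invr_gt0.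
have [g [e' [[cg ce'] [[M gM] [H' eH']] [en' gN] [geta gn] [sa sb]]]] :=
  concentrable_bounded a0 b0 ab ba p1 p2 p3 ce en eH N.
(* [M] covers the support of g, and [N + 1] lets the radii tend to infinity. *)
exists (fun x => F x + g x, e', Num.max (N + 1) M); split; split => /=.
- by split => //; exact: continuous_fun_add.
- split.
    move=> x; rewrite gt_max => /andP[xN xM]; rewrite FN ?gM ?addr0//.
    by rewrite (lt_trans _ xN)// ltrDl.
  by rewrite le_max -natr1 lerD2r nN.
- by split => //; exists H'.
- rewrite (_ : (fun _ => _) = fun x => (F x - e x) + (g x + (e x - e' x))).
    by rewrite -(addr0 0); exact: lattice_sums_toD.
  by apply/funext => x; ring.
- by rewrite -(addr0 1); exact: lattice_sums_toD.
- by rewrite le_max lerDl ler01.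
- by move=> x xN; rewrite gN ?addr0.
- by move=> x xN; rewrite FN ?add0r.
- by move=> x; rewrite -subr_eq0 addrAC subrr add0r; exact: gn.
Qed.

(** Lattice points are excluded because corrections may meet their coset at every stage. *)
Lemma exists_tiling_01 (R : realType) (a b : R) :
  0 < a -> 0 < b -> rationally_independent a b -> rationally_independent b a ->
  exists f : R -> R,
    [/\ continuous f,
        (forall eps, 0 < eps -> exists M, forall x, M < `|x| -> `|f x| <= eps),
        (forall x, (forall k : int, x != k%:~R * a) ->
          finsums_to (fun k : int => f (x - k%:~R * a)) 0) &
        (forall x, (forall k : int, x != k%:~R * b) ->
          finsums_to (fun k : int => f (x - k%:~R * b)) 1)].
Proof.
move=> a0 b0 ab ba.
have [next nextP] : exists next : nat -> _ -> _, forall n S, stage a b n S ->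
    stage a b n.+1 (next n S) /\ refines a b n S (next n S).
  suff /choice[nx nxP] : forall u : nat * ((R -> R) * (R -> R) * R), exists S',
      stage a b u.1 u.2 -> stage a b u.1.+1 S' /\ refines a b u.1 u.2 S'.
    by exists (fun n S => nx (n, S)) => n S; exact: (nxP (n, S)).
  move=> [n S]; have [st|nst] := pselect (stage a b n S).
    by have [S' S'P] := next_stage a0 b0 ab ba st; exists S'.
  (* Choice asks for a successor of every triple; for one that is not a stage the condition is
     vacuous and the triple itself is a default. *)
  by exists S => /nst.
pose S := fix S n := if n is n'.+1 then next n' (S n') else (tent b, tent b, b).
have stS n : stage a b n (S n).
  elim: n => [|n IH]; last by have [] := nextP _ _ IH.
  split => /=.
  - by split; exact: continuous_tent.
  - by split; [exact: tent_support|exact: ltW].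
  - by rewrite divr1; split; [exact: tent_support|exists 1 => x; exact: tent_norm_le1].
  - by move=> x; apply: finsums_to_zero => k; rewrite subrr.
  - exact: tent_lattice_sum.
have rfS n : refines a b n (S n) (S n.+1) by have [] := nextP _ _ (stS n).
pose F n := (S n).1.1; pose N n := (S n).2.
have Nmono : {homo N : n m / (n <= m)%N >-> n <= m}.
  by apply: homo_leq => [//|y x z|n]; [exact: le_trans|case: (rfS n)].
have Nn n : n%:R <= N n by case: (stS n) => _ [].
have Fstable n m x : (n <= m)%N -> `|x| <= N n -> F m x = F n x.
  move=> nm xN; elim: m nm => [|m IH]; first by rewrite leqn0 => /eqP ->.
  rewrite leq_eqVlt => /orP[/eqP ->//|nm]; rewrite -IH//.
  have [_ h _ _] := rfS m; apply: h.
  exact: (le_trans xN (Nmono n m nm)).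
have Fsmall n m x : (n <= m)%N -> N n < `|x| -> `|F m x| <= n.+1%:R^-1.
  move=> nm xN; elim: m nm => [|m IH].
    rewrite leqn0 => /eqP n0; rewrite n0 in xN; have [_ [h _] _ _ _] := stS 0.
    by rewrite /F h ?normr0 ?invr_ge0.
  rewrite leq_eqVlt => /orP[/eqP nm|nm].
    rewrite nm in xN; have [_ [h _] _ _ _] := stS m.+1.
    by rewrite /F h ?normr0 ?invr_ge0.
  have [_ h1 h2 _] := rfS m.
  have [xm|xm] := leP `|x| (N m); first by rewrite /F h1//; exact: IH.
  by rewrite (le_trans (h2 _ xm))// lef_pV2 ?posrE// ler_nat.
(* From stage n on, changes occur within 2 b / (n + 1) of both lattices, so a point farther than
   that from either one sees none. *)
have Fnear c n m x : c = a \/ c = b -> (n <= m)%N ->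
    ~ near_lattice c (2 * (b / n.+1%:R)) x -> F m x = F n x.
  move=> cab nm xn; elim: m nm => [|m IH]; first by rewrite leqn0 => /eqP ->.
  rewrite leq_eqVlt => /orP[/eqP ->//|nm]; rewrite -IH//.
  apply/eqP/negPn/negP => FF; have [_ _ _ h] := rfS m.
  have [h1 h2] := h _ FF; apply: xn.
  apply: (@near_lattice_le _ _ (2 * (b / m.+1%:R))).
    by rewrite ler_pM2l// ler_pM2l// lef_pV2 ?posrE// ler_nat.
  by case: cab => ->.
(* The index exceeds |x| and is at most the radius of its stage, so the value at x is already
   final. *)
pose f x := F (Num.truncn `|x|).+1 x.
have fF n x : `|x| <= N n -> f x = F n x.
  move=> xN; set m := (Num.truncn `|x|).+1.
  have xm : `|x| <= N m by apply: le_trans (Nn m); rewrite ltW// truncnS_gt.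
  have [nm|/ltnW nm] := leqP n m; first exact: Fstable.
  by symmetry; exact: Fstable.
have fnear c n x : c = a \/ c = b ->
    ~ near_lattice c (2 * (b / n.+1%:R)) x -> f x = F n x.
  move=> cab xn; pose m := maxn n (Num.truncn `|x|).+1.
  rewrite -(Fnear c n m x cab)// ?leq_maxl//; apply: fF.
  apply: le_trans (Nn m); rewrite (le_trans (ltW (truncnS_gt _)))// ler_nat.
  exact: leq_maxr.
have index c x : 0 < c -> (forall k : int, x != k%:~R * c) ->
    exists n, ~ near_lattice c (2 * (b / n.+1%:R)) x.
  move=> c0 xc; have [r r0 xr] := away_from_lattice c0 xc.
  exists (Num.truncn (2 * b / r)) => h; apply: xr; apply: near_lattice_le h.
  rewrite mulrA ler_pdivrMr// [leRHS]mulrC -ler_pdivrMr//; exact/ltW/truncnS_gt.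
exists f; split.
- move=> x; pose n := (Num.truncn `|x|).+1.
  have [[cF _] _ _ _ _] := stS n.
  have xn : `|x| < N n by apply: lt_le_trans (Nn n); exact: truncnS_gt.
  rewrite /continuous_at (fF n)//; last exact: ltW.
  have Ff : \forall y \near x, F n y = f y.
    have : \forall y \near x, `|y| < N n.
      exact: (@cvgr_norm_lt R R^o R (nbhs x) _ id x (@cvg_id _ _ ) _ xn).
    by apply: filterS => y /ltW yn; rewrite (fF n).
  exact: cvg_trans (near_eq_cvg Ff) (cF x).
- move=> eps eps0; pose n := Num.truncn eps^-1; exists (N n) => x xn.
  set m := maxn n (Num.truncn `|x|).+1.
  rewrite (fF m).
    rewrite (le_trans (Fsmall n _ _ _ xn)) ?leq_maxl//.
    by rewrite -[leRHS]invrK lef_pV2 ?posrE ?invr_gt0//; exact/ltW/truncnS_gt.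
  apply: le_trans (Nn m); rewrite (le_trans (ltW (truncnS_gt _)))// ler_nat.
  exact: leq_maxr.
- move=> x xa; have [n xn] := index a x a0 xa.
  have [_ _ [en _] Fe _] := stS n.
  (* All points of the coset are as far from the lattice as x: there f agrees with [F n], and the
     profile of stage n, living within b / (n + 1) of 0, vanishes. *)
  rewrite (_ : (fun _ => _) = fun k : int => F n (x - k%:~R * a) - (S n).1.2 (x - k%:~R * a)).
    exact: Fe.
  apply/funext => k; rewrite (fnear a n); [|by left|by move/near_latticeB].
  rewrite en ?subr0// ltNge; apply/negP => h; apply: xn; exists k.
  apply: le_trans h _; rewrite ler_peMl ?ler1n// divr_ge0// ltW//.
- move=> x xb; have [n xn] := index b x b0 xb.
  have [_ _ _ _ Fb] := stS n.
  rewrite (_ : (fun _ => _) = fun k : int => F n (x - k%:~R * b)); first exact: Fb.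
  by apply/funext => k; rewrite (fnear b n)//; [right|move/near_latticeB].
Qed.

(** * Complex combinations and the exceptional null set *)

(** The embedding of [R] into [R[i]] is isometric. A general filter serves both continuity and the
    limit at infinity. *)
Lemma continuous_complex_combination (R : realType) (T : Type) (F : set_system T)
    (FF : Filter F) (g h : T -> R) (u v : R) (p q : R[i]) :
  g t @[t --> F] --> u -> h t @[t --> F] --> v ->
  ((g t)%:C * p + (h t)%:C * q : R[i]^o) @[t --> F] --> (u%:C * p + v%:C * q : R[i]^o).
Proof.
have real_cvg (k : T -> R) (w : R) : k t @[t --> F] --> w ->
    ((k t)%:C : R[i]^o) @[t --> F] --> (w%:C : R[i]^o).
  move=> kw; apply/cvgrPdist_lt => eps eps0.
  (* A positive element of [R[i]] is real. *)
  have epsE : eps = (complex.Re eps)%:C by rewrite RRe_real// gtr0_real.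
  have r0 : 0 < complex.Re eps by move: eps0; rewrite epsE ltcR.
  move/cvgrPdist_lt : kw => /(_ _ r0); apply: filterS => t.
  by rewrite epsE -rmorphB/= normc_def/= expr0n addr0 sqrtr_sqr ltcR.
move=> /real_cvg gu /real_cvg hv.
by apply: (@cvgD _ R[i]^o); apply: (@cvgMl _ _ _ FF).
Qed.

Theorem theorem6p1 (R : realType) (alpha beta : R)
    (alpha_gt0 : 0 < alpha) (beta_gt0 : 0 < beta)
    (indep : rationally_independent alpha beta) (p q : R[i]) :
  exists f : R -> R[i]^o,
    [/\ continuous f,
        vanishes_at_infinity f &
        {ae @lebesgue_measure R, forall x : R,
          absolutely_sums_to (fun k : int => f (x - k%:~R * alpha)) p /\
          absolutely_sums_to (fun k : int => f (x - k%:~R * beta)) q}].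
Proof.
have indep' : rationally_independent beta alpha.
  by move=> n m; rewrite addrC => /indep[-> ->].
(* The [alpha]- and [beta]-sums are 0 and 1 for [h], 1 and 0 for [g]; hence the combination g p + h
   q. *)
have [h [ch h0 hsa hsb]] := exists_tiling_01 alpha_gt0 beta_gt0 indep indep'.
have [g [cg g0 gsb gsa]] := exists_tiling_01 beta_gt0 alpha_gt0 indep' indep.
have cvg0 (k : R -> R) : (forall eps, 0 < eps -> exists M, forall x, M < `|x| -> `|k x| <= eps) ->
    k x @[x --> norm_infty R] --> (0 : R).
  move=> k0; apply/cvgrPdist_le => eps eps0; have [M kM] := k0 _ eps0.
  by exists M => // x /= Mx; rewrite sub0r normrN; exact: kM.
exists (fun x => (g x)%:C * p + (h x)%:C * q); split.
- by move=> x; apply: continuous_complex_combination; [exact: cg|exact: ch].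
- rewrite /vanishes_at_infinity.
  rewrite [X in _ --> X](_ : 0 = (0 : R)%:C * p + (0 : R)%:C * q); last by rewrite !mul0r addr0.
  by apply: continuous_complex_combination; exact: cvg0.
have sums c (k l : R -> R) x (s t : R) :
    finsums_to (fun n : int => k (x - n%:~R * c)) s ->
    finsums_to (fun n : int => l (x - n%:~R * c)) t ->
    absolutely_sums_to (fun n : int =>
      (k (x - n%:~R * c))%:C * p + (l (x - n%:~R * c))%:C * q) (s%:C * p + t%:C * q).
  move=> ks lt; apply: absolutely_sums_to_finsums; apply: finsums_toD.
    by apply: (finsums_to_morph (phi := fun y : R => y%:C * p : R[i]^o)) ks;
      [move=> y z; rewrite rmorphD mulrDl|rewrite mul0r].
  by apply: (finsums_to_morph (phi := fun y : R => y%:C * q : R[i]^o)) lt;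
    [move=> y z; rewrite rmorphD mulrDl|rewrite mul0r].
(* The points of both lattices: a countable, hence null, set. *)
pose Z := range (fun u : bool * int => u.2%:~R * if u.1 then alpha else beta).
have cZ : countable Z by apply: card_le_trans (card_image_le _ _) _; exact: countableP.
exists Z; split.
- by apply: countable_measurable => //; move=> y; exact: measurable_set1.
- exact: countable_lebesgue_measure0.
move=> x /= nx; apply: contrapT => xZ; apply: nx.
have xa (k : int) : x != k%:~R * alpha by apply/eqP => xE; apply: xZ; exists (true, k).
have xb (k : int) : x != k%:~R * beta by apply/eqP => xE; apply: xZ; exists (false, k).
split.
  have := sums _ _ _ x _ _ (gsa x xa) (hsa x xa).
  by rewrite mul1r mul0r addr0.
have := sums _ _ _ x _ _ (gsb x xb) (hsb x xb).
by rewrite mul1r mul0r add0r.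
Qed.
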